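(* For any integers $q>q_0$ and $1\le a,b\le\rho_C$, if $\gcd(a,\rho_C)\mid \gcd(b,\rho_C)=\gcd(q,\rho_C)$, the integers $\gcd(a,\rho_C)$ and $\gcd(b,\rho_C)$ are combinatorially equivalent with respect to $\mathcal{A}$, and $[\mathbf a_J]_q\in\mathrm{Col}_q(A_J)$ for all $J\subseteq[m]$ with $\bar r(J)=r(J)$, then $$0<w_j(\mathcal{A})=\gamma_j(1)\le\gamma_j(a)\le\gamma_j(b)=\beta_j(q)\quad\text{for all } 0\le j\le s.$$ Moreover, when $\mathbf a=\mathbf 0$, for any integers $q\ge 1$ and $1\le a,b\le\rho_C$, if $\gcd(a,\rho_C)\mid \gcd(b,\rho_C)=\gcd(q,\rho_C)$, then $$0<w_j(\mathcal{A})=\gamma_j(1)\le\gamma_j(a)\le\gamma_j(b)=\beta_j(q)\quad\text{for all } 0\le j\le s.$$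
   Context: Let $A$ be an $m\times n$ integer matrix with nonzero rows $\boldsymbol\alpha_1^T,\dots,\boldsymbol\alpha_m^T$, $\mathbf a=(a_1,\dots,a_m)^T\in\mathbb{Z}^m$, and $[m]=\{1,\dots,m\}$. (Italic $a,b$ are integers, bold $\mathbf a$ is a vector.) Let $\mathcal{A}=\{H_1,\dots,H_m\}$ be the hyperplane arrangement in $\mathbb{R}^n$ with $H_i=\{\mathbf x\in\mathbb{R}^n:\boldsymbol\alpha_i^T\mathbf x=a_i\}$, and let $$\chi(\mathcal{A},t)=\sum_{J\subseteq[m],\ \bigcap_{j\in J}H_j\ne\emptyset}(-1)^{\#J}t^{\dim(\bigcap_{j\in J}H_j)}$$ be its characteristic polynomial (the intersection for $J=\emptyset$ being $\mathbb{R}^n$). Let $s=\operatorname{rank}(A)$. The numbers $w_j(\mathcal{A})$ are defined by $\chi(\mathcal{A},t)=\sum_{j=0}^s(-1)^{j}w_j(\mathcal{A})t^{n-j}$. For a positive integer $q$, $\mathbb{Z}_q=\mathbb{Z}/q\mathbb{Z}$, $[\cdot]_q$ is the entrywise reduction modulo $q$, $\mathrm{Col}_q(N)$ is the $\mathbb{Z}_q$-module generated by the columns of $[N]_q$, and $H_{i,q}=\{\mathbf x\in\mathbb{Z}_q^n:[\boldsymbol\alpha_i^T]_q\mathbf x=[a_i]_q\}$. For $J\subseteq[m]$, let $A_J$ and $\mathbf a_J$ consist of the rows of $A$ and entries of $\mathbf a$ indexed by $J$; $r(J)=\operatorname{rank}A_J$, $\bar r(J)=\operatorname{rank}[A_J\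 \mathbf a_J]$ (ranks over $\mathbb{Q}$). The invariant factors of an integer matrix are the nonzero diagonal entries (taken positive, each dividing the next) of its Smith normal form; let $d_{J,1}\mid\cdots\mid d_{J,r(J)}$ be those of $A_J$ and $\bar d_{J,1}\mid\cdots\mid\bar d_{J,\bar r(J)}$ those of $[A_J\ \mathbf a_J]$. Put $\rho_C=\operatorname{lcm}\{d_{J,r(J)}: J\subseteq[m],\ \bar r(J)=r(J)\}$ and $q_0=\max\{\bar d_{J,\bar r(J)}: J\subseteq[m],\ \bar r(J)=r(J)+1\}$, with $q_0=0$ if no such $J$ exists; $d_{J,0}=1$. For $J$ with $\bar r(J)=r(J)$ and a positive integer $q$, let $\tilde d_J(q)=\prod_{j=1}^{r(J)}\gcd(d_{J,j},q)$ if $\gcd(q,d_{J,j})=\gcd(q,\bar d_{J,j})$ for all $j=1,\dots,r(J)$, and $\tilde d_J(q)=0$ otherwise. For $0\le j\le s$ and a positive integer $q$ set $$\beta_j(q)=(-1)^{j}\sum_{J\subseteq[m],\ \bar r(J)=r(J)=j}(-1)^{\#J}\tilde d_J(q),$$ and for $1\le a\le\rho_C$ let $\gamma_j(a)$ be given by the same formula with $q$ replaced by $a$. These are the unsigned coefficients of the characteristic quasi-polynomial $\chi^{\mathrm{quasi}}(\mathcal{A},q)=\sum_{j=0}^s(-1)^{j}\beta_j(q)q^{n-j}$ and of its $a$-constituent $f_a(\mathcal{A},t)=\sum_{j=0}^s(-1)^{j}\gamma_j(a)t^{n-j}$. Two positive integers $a,b$ are combinatorially equivalent with respect to $\mathcal{A}$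 if for all $J\subseteq[m]$ with $\bar r(J)=r(J)$: $\bigcap_{j\in J}H_{j,a}\ne\emptyset\iff\bigcap_{j\in J}H_{j,b}\ne\emptyset$ (the intersection for $J=\emptyset$ being the whole of $\mathbb{Z}_a^n$, respectively $\mathbb{Z}_b^n$). *)

(* Defs.v *)
From HB Require Import structures.
From mathcomp Require Import all_boot all_order all_algebra.
From mathcomp Require Import boolp classical_sets reals.

Set Implicit Arguments.
Unset Strict Implicit.
Unset Printing Implicit Defensive.

Import Order.TTheory GRing.Theory Num.Theory.
Local Open Scope ring_scope.

(* Z/qZ for every q >= 1, the zero ring q = 1 included: the library's 'Z_q is
   Z/2Z when q = 1, hence this alias, which is a commutative ring that is
   allowed to be trivial.  Only q > 0 is meaningful. *)
Definition Zmod (q : nat) : Type := 'I_q.-1.+1.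

HB.instance Definition _ (q : nat) := Finite.on (Zmod q).
HB.instance Definition _ (q : nat) :=
  GRing.isZmodule.Build (Zmod q)
    (@Zp_addA q.-1.+1) (@Zp_addC q.-1.+1) (@Zp_add0z q.-1) (@Zp_addNz q.-1).
HB.instance Definition _ (q : nat) :=
  GRing.Zmodule_isComPzRing.Build (Zmod q)
    (@Zp_mulA q.-1.+1) (@Zp_mulC q.-1.+1) (@Zp_mul1z q.-1)
    (@Zp_mul_addl q.-1.+1).

Definition redmx (q m n : nat) (M : 'M[int]_(m, n)) : 'M[Zmod q]_(m, n) :=
  map_mx intr M.

Definition Colq (q m n : nat) (N : 'M[int]_(m, n)) : {set 'cV[Zmod q]_m} :=
  [set \sum_(k < n) x k *: col k (redmx q N) | x : {ffun 'I_n -> Zmod q}]%SET.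

Definition rankQ (m n : nat) (M : 'M[int]_(m, n)) : nat :=
  \rank (map_mx intr M : 'M[rat]_(m, n)).

(* The library's Smith normal form theorem returns a sequence d of which only
   the entries of index < minn m n (0 past the end of d) occur in the m x n
   matrix. *)
Definition smith_diag (m n : nat) (M : 'M[int]_(m, n)) : seq int :=
  let: existT2 _ _ (existT2 _ _ (exist2 d _ _)) := int_Smith_normal_form M in
  [seq d`_i | i <- iota 0 (minn m n)].

Definition invariant_factors (m n : nat) (M : 'M[int]_(m, n)) : seq nat :=
  [seq `|z|%N | z <- smith_diag M & z != 0].

(* The j-th invariant factor with the 1-based indexing of the text. *)
Definition invariant_factor (m n : nat) (M : 'M[int]_(m, n)) (j : nat) : nat :=
  if j is j'.+1 then nth 0%N (invariant_factors M) j' else 1%N.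

(* S has dimension k if it is a translate of a k-dimensional linear subspace;
   the value 0 on sets that are not nonempty affine subspaces is a dummy. *)
Definition affine_dim (K : fieldType) (V : vectType K) (S : set V) : nat :=
  xget 0%N [set k : nat | exists (x0 : V) (U : {vspace V}),
              S = [set x | x - x0 \in U]%classic /\ \dim U = k]%classic.

Section Arrangement.
Variables (m n : nat) (A : 'M[int]_(m, n)) (av : 'cV[int]_m).
Implicit Types (i : 'I_m) (J : {set 'I_m}) (j q a b : nat).

Definition rowsof (p : nat) (M : 'M[int]_(m, p)) J : 'M[int]_(#|J|, p) :=
  rowsub (fun k : 'I_#|J| => enum_val k) M.

Definition augmented J : 'M[int]_(#|J|, n + 1) :=
  row_mx (rowsof A J) (rowsof av J).

Definition rk J : nat := rankQ (rowsof A J).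
Definition rkbar J : nat := rankQ (augmented J).

Definition dinv J j : nat := invariant_factor (rowsof A J) j.
Definition dbarinv J j : nat := invariant_factor (augmented J) j.

Definition rhoC : nat :=
  (\big[lcmn/1]_(J : {set 'I_m} | rkbar J == rk J) dinv J (rk J))%N.

Definition q0 : nat :=
  (\max_(J : {set 'I_m} | rkbar J == (rk J).+1) dbarinv J (rkbar J))%N.

Definition dtilde J q : nat :=
  if [forall k : 'I_(rk J), gcdn q (dinv J k.+1) == gcdn q (dbarinv J k.+1)]
  then (\prod_(k < rk J) gcdn (dinv J k.+1) q)%N
  else 0%N.

Definition beta j q : int :=
  (-1) ^+ j * \sum_(J : {set 'I_m} | (rkbar J == rk J) && (rk J == j))
                (-1) ^+ #|J| * (dtilde J q)%:Z.

Definition gamma j a : int := beta j a.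

Definition hyperplane_mod q i : {set 'cV[Zmod q]_n} :=
  [set x | row i (redmx q A) *m x == row i (redmx q av)]%SET.

Definition flat_mod q J : {set 'cV[Zmod q]_n} :=
  (\bigcap_(i in J) hyperplane_mod q i)%SET.

Definition comb_equiv a b : Prop :=
  forall J, rkbar J = rk J ->
    (flat_mod a J != finset.set0 <-> flat_mod b J != finset.set0).

Section Real.
Variable R : realType.

Definition hyperplane i : set 'cV[R]_n :=
  [set x | row i (map_mx intr A) *m x = row i (map_mx intr av)]%classic.

Definition flat J : set 'cV[R]_n :=
  (\bigcap_(i in [set` J]) hyperplane i)%classic.

Definition charpoly : {poly int} :=
  \sum_(J : {set 'I_m} | `[< flat J !=set0 >]%classic)
     (-1) ^+ #|J| *: 'X^(affine_dim (flat J)).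

(* Coefficient extraction: charpoly = \sum_(0 <= j <= s) (-1)^j w_j t^(n - j)
   with s = rankQ A <= n, so the exponents n - j are distinct. *)
Definition whitney j : int := (-1) ^+ j * charpoly`_(n - j).

End Real.
End Arrangement.

(* Main.v *)
Require Import Defs.
From mathcomp Require Import all_boot all_order all_algebra.
From mathcomp Require Import boolp classical_sets reals.
(* [fintype] and [finset] again, so that [set0], [subsetP] and the like are about
   finite sets. *)
From mathcomp Require Import fintype finset.

(** For [J] consistent of rank [j], the product of the [gcd(d_{J,k}, c)] counts
    the homomorphisms to [Z/c] of the saturation of the row lattice of [A_J]
    that vanish on the rows of [A_J]; it equals [dtilde_J(c)] as soon as the
    system of [J] is solvable modulo [c].  Grouping the sets [J] by
    their closure [X] in the matroid of the augmented rows, all [J] of a group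
    share one saturated lattice [S], and exchanging the sums gives

      beta_j(c) = sum_X sum_{phi : S -> Z/c} T(X cap {i | phi(alpha_i) = 0})

    where [T(E)] is [(-1)^j] times the alternating sum over the subsets of [E]
    that span [S], a value of the Tutte polynomial: nonnegative, and positive for
    [E = X] because no row of [A] vanishes.  If [a] divides [b] then
    [Hom(S, Z/a)] embeds into [Hom(S, Z/b)] compatibly with vanishing at
    [alpha_i], so [beta_j] is monotone for divisibility; at [c = 1] it is the
    Whitney number.  Solvability modulo [q] passes to every [c] with
    [gcd(c, rhoC)] dividing [q], since [rhoC] kills the torsion of the
    cokernels. *)

Set Implicit Arguments.
Unset Strict Implicit.
Unset Printing Implicit Defensive.

Import Order.TTheory GRing.Theory Num.Theory.
Local Open Scope ring_scope.

(** * Matroid rank functions and alternating sums over spanning subsets *)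

Definition matroid_rank (I : finType) (r : {set I} -> nat) : Prop :=
  (forall (e : I) (J : {set I}), (r J <= r (e |: J) <= (r J).+1)%N) /\
  (forall (e : I) (J K : {set I}),
     J \subset K -> r (e |: J) = r J -> r (e |: K) = r K).

Section Matroid.
Variables (I : finType) (r : {set I} -> nat).
Hypothesis rP : matroid_rank r.

Lemma rank_setU1 (e : I) (C : {set I}) :
  r (e |: C) != r C -> r (e |: C) = (r C).+1.
Proof.
move=> re; case/andP: (rP.1 e C) => le1 le2.
by apply/eqP; rewrite eqn_leq le2 ltn_neqAle eq_sym re.
Qed.

Lemma rank_setU (J K : {set I}) : (r J <= r (K :|: J))%N.
Proof.
elim: {K}#|K| {-2}K (erefl #|K|) => [K /eqP|k IHk K cardK].
  by rewrite cards_eq0 => /eqP->; rewrite set0U.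
have /card_gt0P[e eK] : (0 < #|K|)%N by rewrite cardK.
rewrite -(setD1K eK) -setUA (leq_trans (IHk (K :\ e) _)) //; last first.
  by case/andP: (rP.1 e (K :\ e :|: J)).
by move: cardK; rewrite (cardsD1 e) eK => -[].
Qed.

Lemma rank_subset (J K : {set I}) : J \subset K -> (r J <= r K)%N.
Proof. by move/setUidPl=> <-; exact: rank_setU. Qed.

Lemma rank_closure (J K : {set I}) :
  (forall i, i \in K -> r (i |: J) = r J) -> r (K :|: J) = r J.
Proof.
elim: {K}#|K| {-2}K (erefl #|K|) => [K /eqP|k IHk K cardK clK].
  by rewrite cards_eq0 => /eqP->; rewrite set0U.
have /card_gt0P[e eK] : (0 < #|K|)%N by rewrite cardK.
rewrite -(setD1K eK) -setUA (rP.2 _ J) ?subsetUr ?clK // IHk //.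
  by move: cardK; rewrite (cardsD1 e) eK => -[].
by move=> i /setD1P[_ iK]; exact: clK.
Qed.

(** Greedy growth: some element raises the rank as long as the set does not span, for otherwise
    [rank_closure] would give it the full rank. *)
Lemma ex_independent (j : nat) : (j <= r setT)%N -> r set0 = 0%N ->
  exists2 J : {set I}, #|J| = j & r J = j.
Proof.
move=> le_jr r0; elim: j le_jr => [|j IHj] lt_jr.
  by exists set0; rewrite ?cards0.
have [J cardJ rJ] := IHj (ltnW lt_jr).
have [/existsP[i ri]|] := boolP [exists i, r (i |: J) != r J].
  exists (i |: J); last by rewrite rank_setU1 // rJ.
  rewrite cardsU1 cardJ.
  case: (boolP (i \in J)) => // iJ; move: ri; rewrite (setUidPr _) ?eqxx //.
  by rewrite sub1set.
rewrite negb_exists => /forallP clJ; move: lt_jr.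
rewrite -(setTU J) rank_closure ?rJ ?ltnn // => i _.
by apply/eqP; move: (clJ i); rewrite negbK rJ.
Qed.

(* The value T(1,0) of the Tutte polynomial of the matroid on [E] contracted by
   [C]. *)
Definition rank_sum (C E : {set I}) : int :=
  (-1) ^+ (r (E :|: C) - r C) *
  \sum_(J : {set I} | (J \subset E) && (r (J :|: C) == r (E :|: C)))
     (-1) ^+ #|J|.

(** Deletion and contraction for signed sums: the subsets containing [e] are the [e |: J], and the
    extra element flips the sign. *)
Lemma sum_subsetU1 (e : I) (E : {set I}) (P : pred {set I}) :
  e \notin E ->
  \sum_(J : {set I} | (J \subset e |: E) && P J) (-1) ^+ #|J| =
  \sum_(J : {set I} | (J \subset E) && P J) (-1) ^+ #|J|
  - \sum_(J : {set I} | (J \subset E) && P (e |: J)) (-1) ^+ #|J| :> int.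
Proof.
move=> eE; have notin_sub (J : {set I}) : J \subset E -> e \notin J.
  by move/subsetP=> sJE; apply: contra eE => /sJE.
rewrite (bigID (fun J : {set I} => e \in J)) /= addrC; congr (_ + _).
  apply: eq_bigl => J; rewrite -andbA [P J && _]andbC andbA; congr (_ && _).
  apply/andP/idP => [[sJ eJ]|sJ]; last first.
    by rewrite notin_sub // (subset_trans sJ) // subsetUr.
  apply/subsetP => i iJ; have /setU1P[ie|//] := subsetP sJ i iJ.
  by rewrite -ie iJ in eJ.
rewrite (reindex_onto (fun J => e |: J) (fun J => J :\ e)) /=; last first.
  by move=> J /andP[_ eJ]; rewrite setD1K.
rewrite -sumrN; apply: eq_big => [J|J].
  rewrite setU11 andbT; apply/andP/andP => [[/andP[sJ PJ] /eqP JE]|[sJ PJ]].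
    split=> //; apply/subsetP => i iJ.
    have /setU1P[ie|//] := subsetP sJ i (setU1r e iJ).
    by move: iJ; rewrite -JE ie !inE eqxx.
  by rewrite PJ setUS //= setU1K // notin_sub.
case/andP=> /andP[_ _] /eqP JE; rewrite cardsU1 -JE !inE eqxx /= setU1K.
  by rewrite exprS mulN1r.
by rewrite -JE !inE eqxx.
Qed.

Lemma rank_sum0 (C : {set I}) : rank_sum C set0 = 1.
Proof.
rewrite /rank_sum set0U subnn expr0 mul1r (big_pred1 set0) ?cards0 // => J.
by rewrite subset0 andb_idr // => /eqP->; rewrite set0U.
Qed.

(** Toggling the loop [e] keeps the rank condition and flips the sign, so the terms cancel in
    pairs. *)
Lemma rank_sum_loop (e : I) (C E : {set I}) : e \notin E ->
  r (e |: C) = r C -> rank_sum C (e |: E) = 0.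
Proof.
move=> eE re; rewrite /rank_sum sum_subsetU1 //.
have reK (K : {set I}) : r (e |: K :|: C) = r (K :|: C).
  by rewrite -setUA (rP.2 e C) ?subsetUr.
rewrite reK; under [X in _ - X]eq_bigl => J do rewrite reK.
by rewrite subrr mulr0.
Qed.

(** The minus sign of the contraction term is absorbed because the rank of the contracted set grows
    by one. The deletion term disappears for a coloop [e]: no subset of [E] then reaches the rank of
    [e |: E]. *)
Lemma rank_sumU1 (e : I) (C E : {set I}) : e \notin E -> r (e |: C) != r C ->
  rank_sum C (e |: E) =
  rank_sum C E *+ (r (e |: E :|: C) == r (E :|: C)) + rank_sum (e |: C) E.
Proof.
move=> eE re; have reC := rank_setU1 re.
have eK (K : {set I}) : e |: K :|: C = K :|: (e |: C).
  by rewrite -setUA setUCA.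
rewrite /rank_sum sum_subsetU1 // mulrBr; congr (_ + _); last first.
  under eq_bigl => J do rewrite eK.
  rewrite -mulNr eK reC; congr (_ * _).
  have le_r : (r C < r (E :|: (e |: C)))%N by rewrite -reC rank_setU.
  by rewrite -(subnSK le_r) exprS mulN1r opprK.
case: eqP => [->|ne] //; rewrite mulr0n big1 ?mulr0 // => J /andP[sJ /eqP rJ].
case: ne; apply/eqP; rewrite eqn_leq -{1}rJ !rank_subset ?setSU ?subsetUr //.
Qed.

Lemma rank_sum_ge0 (C E : {set I}) : 0 <= rank_sum C E.
Proof.
elim: {E}#|E| {-2}E (erefl #|E|) C => [E /eqP + C|k IHk E cardE C].
  by rewrite cards_eq0 => /eqP->; rewrite rank_sum0.
have /card_gt0P[e eE] : (0 < #|E|)%N by rewrite cardE.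
have cardE1 : #|E :\ e| = k by move: cardE; rewrite (cardsD1 e) eE => -[].
have eE1 : e \notin E :\ e by rewrite setD11.
rewrite -(setD1K eE); case: (eqVneq (r (e |: C)) (r C)) => [re|re].
  by rewrite rank_sum_loop.
by rewrite rank_sumU1 // addr_ge0 ?mulrn_wge0 // IHk.
Qed.

(** If [e] is not a coloop, its deletion is still loopless and contributes a positive term. If it is
    one, its contraction stays loopless, since nothing is parallel to a coloop. *)
Lemma rank_sum_gt0 (C E : {set I}) :
  (forall i, i \in E -> r (i |: C) != r C) -> 0 < rank_sum C E.
Proof.
elim: {E}#|E| {-2}E (erefl #|E|) C => [E /eqP + C _|k IHk E cardE C loopless].
  by rewrite cards_eq0 => /eqP->; rewrite rank_sum0.
have /card_gt0P[e eE] : (0 < #|E|)%N by rewrite cardE.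
have cardE1 : #|E :\ e| = k by move: cardE; rewrite (cardsD1 e) eE => -[].
have eE1 : e \notin E :\ e by rewrite setD11.
have reE := loopless e eE; have reC := rank_setU1 reE.
rewrite -(setD1K eE) rank_sumU1 //; case: eqP => [_|coloop].
  by rewrite mulr1n ltr_pwDl ?rank_sum_ge0 // IHk // => i /setD1P[_ /loopless].
rewrite mulr0n add0r IHk // => i /setD1P[ie iE]; apply/eqP => ri.
(* [i] would be parallel to [e], so that [e] would not be a coloop. *)
case: coloop; rewrite -setUA (rP.2 e (i |: C)) //.
  by rewrite setSU // sub1set !inE ie.
by rewrite setUCA ri reC rank_setU1 // loopless.
Qed.
End Matroid.

(** * The linear matroid on the rows of a matrix *)

Section RowRank.
Variables (F : fieldType) (m p : nat) (B : 'M[F]_(m, p)).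
Implicit Types J K : {set 'I_m}.

Let rows J := rowsub (fun k : 'I_#|J| => enum_val k) B.

Lemma row_rowsub_enum J i : i \in J -> (row i B <= rows J)%MS.
Proof.
move=> iJ; suff -> : row i B = row (enum_rank_in iJ i) (rows J).
  exact: row_sub.
by rewrite row_rowsub enum_rankK_in.
Qed.

Lemma rowsub_enum_subP J k (W : 'M[F]_(k, p)) :
  reflect (forall i, i \in J -> (row i B <= W)%MS) (rows J <= W)%MS.
Proof.
apply: (iffP idP) => [sJW i iJ|sJW].
  exact: submx_trans (row_rowsub_enum iJ) sJW.
by apply/row_subP => i; rewrite row_rowsub sJW ?enum_valP.
Qed.

Lemma rowsub_enumU1 J i : (rows (i |: J) :=: row i B + rows J)%MS.
Proof.
apply/eqmxP/andP; split.
  apply/rowsub_enum_subP => k /setU1P[->|kJ]; first exact: addsmxSl.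
  by rewrite (submx_trans (row_rowsub_enum kJ)) // addsmxSr.
rewrite addsmx_sub row_rowsub_enum ?setU11 //=.
by apply/rowsub_enum_subP => k kJ; rewrite row_rowsub_enum // setU1r.
Qed.

Lemma rank_rowsub_matroid : matroid_rank (fun J => \rank (rows J)).
Proof.
split=> [i J|i J K sJK].
  rewrite rowsub_enumU1 mxrankS ?addsmxSr //=.
  apply: leq_trans (mxrank_adds_leqif _ _) _.
  exact: leq_add (rank_leq_row (row i B)) (leqnn _).
have sU L : (rows L <= rows (i |: L))%MS by rewrite rowsub_enumU1 addsmxSr.
move/eqP; rewrite eq_sym (mxrank_leqif_sup (sU J)).2 rowsub_enumU1 addsmx_sub.
case/andP=> iJ _; apply/eqP; rewrite eq_sym (mxrank_leqif_sup (sU K)).2.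
rewrite rowsub_enumU1 addsmx_sub submx_refl andbT (submx_trans iJ) //.
by apply/rowsub_enum_subP => k kJ; rewrite row_rowsub_enum ?(subsetP sJK).
Qed.
End RowRank.

(** * Smith normal form and invariant factors *)

Lemma dvdz_transitive : transitive dvdz.
Proof. by move=> x y z; exact: dvdz_trans. Qed.

(** In a divisibility chain the zeros come last, so filtering them out shifts no index, and the
    default 0 of [nth] replaces them. *)
Lemma nth_nonzero_absz (s : seq int) i : sorted dvdz s ->
  nth 0%N [seq `|z|%N | z <- s & z != 0] i = `|nth 0%R s i|%N.
Proof.
elim: s i => [|z s IHs] i /= => [_|pzs]; first by rewrite !nth_nil.
have ss := path_sorted pzs; case: eqP pzs => [->|_] /= pzs.
  have s0 x : x \in s -> x = 0.
    move/(allP (order_path_min dvdz_transitive pzs)) => dvd0x.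
    by apply/eqP; rewrite -dvd0z.
  rewrite (_ : [seq z <- s | z != 0] = [::]) ?nth_nil; last first.
    apply/eqP; rewrite -[_ == _]negbK -has_filter.
    by apply/hasPn => x /s0->; rewrite eqxx.
  case: i => //= i; case: (ltnP i (size s)) => [lt_is|ge_is].
    by rewrite (s0 _ (mem_nth 0 lt_is)).
  by rewrite nth_default.
by case: i => //= i; rewrite IHs.
Qed.

Definition diagz (m n : nat) (e : nat -> nat) : 'M[int]_(m, n) :=
  \matrix_(i, j) ((e i)%:Z *+ (i == j :> nat)).

Lemma smith_normal_form_seq (m n : nat) (M : 'M[int]_(m, n)) :
  exists L : 'M[int]_m, exists R : 'M[int]_n,
  [/\ L \in unitmx, R \in unitmx,
      M = L *m diagz m n (fun i => invariant_factor M i.+1) *m R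
    & exists2 s : seq int, (sorted dvdz s /\ (size s <= minn m n)%N) &
      invariant_factors M = [seq `|z|%N | z <- s & z != 0]].
Proof.
rewrite /invariant_factor /invariant_factors /smith_diag.
case: int_Smith_normal_form => L unitL [R unitR [d sort_d defM]].
set s := [seq d`_i | i <- iota 0 (minn m n)].
have sort_s : sorted dvdz s.
  apply/(sortedP 0) => i; rewrite size_map size_iota => lti.
  rewrite !(nth_map 0%N) ?size_iota ?nth_iota ?(ltnW lti) // !add0n.
  (* Past the end of [d] the default entry is 0, which everything divides. *)
  have [lt_id|le_di] := ltnP i.+1 (size d); first exact: (sortedP 0 _).
  by rewrite [d`_i.+1]nth_default //; exact: dvdz0.
(* The signs of the diagonal entries are moved into the left factor, which leaves their absolute
   values on the diagonal. *)
pose S := diag_mx (\row_(i < m) (-1) ^+ (d`_i < 0)%R : 'rV[int]_m).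
exists (L *m S), R; split=> //.
- rewrite unitmx_mul unitL unitmxE det_diag.
  by apply: rpred_prod => i _; rewrite mxE unitrX ?unitrN1.
- rewrite {1}defM -!mulmxA; congr (L *m _); rewrite mulmxA; congr (_ *m R).
  rewrite mul_diag_mx; apply/matrixP => i j; rewrite !mxE nth_nonzero_absz //.
  case: eqP => [ij|_]; rewrite ?mulr0n ?mulr0 // !mulr1n.
  have lti : (i < minn m n)%N by rewrite leq_min ltn_ord ij ltn_ord.
  by rewrite /s (nth_map 0%N) ?size_iota // nth_iota // add0n -intEsign.
- by exists s; rewrite ?size_map ?size_iota.
Qed.

Lemma rank_diagz m n (e : nat -> nat) (r : nat) : (r <= minn m n)%N ->
  (forall i, (e i == 0%N) = (r <= i)%N) -> rankQ (diagz m n e) = r.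
Proof.
rewrite leq_min => /andP[le_rm le_rn] e0; rewrite /rankQ.
(* The entries 1 past [r] make [D] invertible over the rationals. *)
pose D : 'M[rat]_n := diag_mx (\row_j if (j < r)%N then (e j)%:R else 1%R).
have -> : map_mx intr (diagz m n e) = pid_mx r *m D.
  rewrite mul_mx_diag; apply/matrixP => i j; rewrite !mxE.
  case: eqP => [ij|_]; last by rewrite mul0r.
  rewrite -ij; case: ltnP => ri; first by rewrite mul1r -pmulrn.
  by move: ri; rewrite -e0 => /eqP->; rewrite mul0r.
rewrite mxrankMfree ?rank_pid_mx // row_free_unit unitmxE det_diag unitfE.
apply/prodf_neq0 => j _; rewrite mxE; case: ltnP => // lt_jr.
by rewrite pnatr_eq0 e0 -ltnNge.
Qed.

Lemma map_unitmx_intr (F : fieldType) k (L : 'M[int]_k) : L \in unitmx ->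
  (map_mx intr L : 'M[F]_k) \in unitmx.
Proof.
move=> uL; have := mulmxV uL => /(congr1 (map_mx (intr : int -> F))).
by rewrite map_mxM map_mx1 => /mulmx1_unit[].
Qed.

Lemma rankQ_unitmx m n (M : 'M[int]_(m, n)) (L : 'M[int]_m) (R : 'M[int]_n) :
  L \in unitmx -> R \in unitmx -> rankQ (L *m M *m R) = rankQ M.
Proof.
move=> uL uR; rewrite /rankQ !map_mxM mxrankMfree; last first.
  by rewrite row_free_unit map_unitmx_intr.
rewrite -mxrank_tr trmx_mul mxrankMfree ?mxrank_tr //.
by rewrite row_free_unit unitmx_tr map_unitmx_intr.
Qed.

Section InvariantFactors.
Variables (m n : nat) (M : 'M[int]_(m, n)).

Lemma invariant_factor_dvd i j : (i <= j)%N ->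
  (invariant_factor M i.+1 %| invariant_factor M j.+1)%N.
Proof.
have [L [R [_ _ _ [s [sort_s _] invE]]]] := smith_normal_form_seq M.
rewrite /= invE !nth_nonzero_absz // => le_ij.
have [lt_js|le_sj] := ltnP j (size s).
  apply: (sorted_leq_nth dvdz_transitive _ 0) => //.
    by move=> x; exact: dvdzz.
  by rewrite inE (leq_ltn_trans le_ij).
by rewrite [nth _ s j]nth_default ?dvdn0.
Qed.

(** The rank is the number of invariant factors, and the value beyond them is the default 0. In the
    counts below such an index contributes [gcdn 0 c = c], a free coordinate. *)
Lemma invariant_factor_eq0 i :
  (invariant_factor M i.+1 == 0%N) = (rankQ M <= i)%N.
Proof.
have [L [R [uL uR defM [s [sort_s le_s] invE]]]] := smith_normal_form_seq M.
set e := fun i => _ in defM.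
have e0 k : (e k == 0%N) = (size (invariant_factors M) <= k)%N.
  rewrite /e /=; case: leqP => [/(nth_default 0%N)->//|ltk]; apply/negbTE.
  have := mem_nth 0%N ltk; rewrite {2}invE => /mapP[z].
  by rewrite mem_filter => /andP[z0 _] ->; rewrite absz_eq0.
rewrite -[_ == _]/(e i == 0%N) e0; congr (_ <= _)%N.
rewrite {2}defM rankQ_unitmx //.
rewrite (@rank_diagz _ _ e (size (invariant_factors M))) //.
rewrite invE size_map size_filter; exact: leq_trans (count_size _ _) le_s.
Qed.

Lemma smith_normal_form : exists L : 'M[int]_m, exists R : 'M[int]_n,
  [/\ L \in unitmx, R \in unitmx &
      M = L *m diagz m n (fun i => invariant_factor M i.+1) *m R].
Proof. by have [L [R [uL uR defM _]]] := smith_normal_form_seq M; exists L, R. Qed.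
End InvariantFactors.

(** * Arithmetic and annihilators in Z/q *)

Section ZmodTheory.
Variable q : nat.
Hypothesis q_gt0 : (0 < q)%N.

Lemma card_Zmod : #|{: Zmod q}| = q.
Proof. by rewrite card_ord prednK. Qed.

Lemma Zmod_natr_val k : val (k%:R : Zmod q) = (k %% q)%N.
Proof.
elim: k => [|k IHk]; first by rewrite mod0n.
rewrite mulrS /= IHk !prednK // modnDmr; case: (ltngtP q 1) => [|q_gt1|->].
- by case: q q_gt0 => [|[]].
- by rewrite (modn_small q_gt1).
- by rewrite !modn1.
Qed.

Lemma Zmod_natr_eq0 k : (k%:R == 0 :> Zmod q) = (q %| k)%N.
Proof. by rewrite -val_eqE Zmod_natr_val. Qed.

Lemma Zmod_intr_eq0 (z : int) : (z%:~R == 0 :> Zmod q) = (q %| z)%Z.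
Proof.
case: z => k; first by rewrite -pmulrn Zmod_natr_eq0.
by rewrite NegzE mulrNz oppr_eq0 -pmulrn Zmod_natr_eq0 dvdzE abszN.
Qed.

Lemma Zmod_ltn (x : Zmod q) : (val x < q)%N.
Proof. by rewrite -[X in (_ < X)%N](prednK q_gt0); exact: ltn_ord. Qed.

Lemma Zmod_natr_id (x : Zmod q) : (val x)%:R = x.
Proof. by apply: val_inj; rewrite Zmod_natr_val modn_small // Zmod_ltn. Qed.

(** With [g = gcdn e q], the annihilator of [e] consists of the [g] multiples of [q / g] below
    [q]. *)
Lemma card_Zmod_ann (e : nat) :
  #|[pred x : Zmod q | e%:R * x == 0]| = gcdn e q.
Proof.
have g_gt0 : (0 < gcdn e q)%N by rewrite gcdn_gt0 q_gt0 orbT.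
set g := gcdn e q in g_gt0 *.
have [q' [e' [qE eE co]]] :
    exists q' e', [/\ q = (q' * g)%N, e = (e' * g)%N & coprime q' e'].
  exists (q %/ g)%N, (e %/ g)%N; rewrite !divnK ?dvdn_gcdl ?dvdn_gcdr //.
  split=> //; rewrite /coprime -(eqn_pmul2r g_gt0) muln_gcdl.
  by rewrite !divnK ?dvdn_gcdl ?dvdn_gcdr // mul1n gcdnC.
have q'_gt0 : (0 < q')%N by move: q_gt0; rewrite qE muln_gt0 => /andP[].
have annE (x : Zmod q) : (e%:R * x == 0) = (q' %| val x)%N.
  rewrite -{1}[x]Zmod_natr_id -natrM Zmod_natr_eq0 {1}qE eE mulnAC.
  by rewrite dvdn_pmul2r // Gauss_dvdr.
pose f (t : 'I_g) : Zmod q := (t * q')%:R.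
have valf t : val (f t) = (t * q')%N.
  by rewrite Zmod_natr_val modn_small // [X in (_ < X)%N]qE mulnC ltn_pmul2l.
have inj_f : injective f.
  move=> t u /(congr1 val); rewrite !valf => /eqP.
  by rewrite eqn_pmul2r // => /eqP/val_inj.
rewrite -[RHS]card_ord -(card_codom inj_f); apply: eq_card => x.
rewrite inE annE; apply/idP/codomP => [/dvdnP[t xE]|[t ->]]; last first.
  by rewrite valf dvdn_mull.
have lt_tg : (t < g)%N.
  by rewrite -(ltn_pmul2r q'_gt0) -xE mulnC -qE Zmod_ltn.
by exists (Ordinal lt_tg); apply: val_inj; rewrite valf.
Qed.
End ZmodTheory.

(** * Sizes of kernels modulo c in terms of invariant factors *)

Lemma card_cV_family (T : finType) n (F : 'I_n -> pred T) :
  #|[set y : 'cV[T]_n | [forall j, y j 0 \in F j]]| = (\prod_(j < n) #|F j|)%N.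
Proof.
pose h (f : {ffun 'I_n -> T}) : 'cV[T]_n := \col_j f j.
have inj_h : injective h.
  by move=> f g /matrixP fg; apply/ffunP => j; move: (fg j 0); rewrite !mxE.
have -> : [set y : 'cV[T]_n | [forall j, y j 0 \in F j]] =
          [set h f | f in family F].
  apply/setP=> y; rewrite inE.
  apply/forallP/imsetP => [Fy|[f /familyP Ff ->] j]; last by rewrite mxE Ff.
  exists [ffun j => y j 0]; first by apply/familyP => j; rewrite ffunE Fy.
  by apply/matrixP => j k; rewrite mxE ffunE ord1.
by rewrite card_imset // card_family foldrE big_map big_enum.
Qed.
Section Kernel.
Variable c : nat.
Hypothesis c_gt0 : (0 < c)%N.

Lemma redmxM m n p (M : 'M[int]_(m, n)) (N : 'M[int]_(n, p)) :
  redmx c (M *m N) = redmx c M *m redmx c N.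
Proof. exact: map_mxM. Qed.

Lemma redmx1 n : redmx c (1%:M : 'M[int]_n) = 1%:M.
Proof. exact: map_mx1. Qed.

Lemma card_kernel_diagz m n (e : nat -> nat) :
  (forall k, (m <= k)%N -> e k = 0%N) ->
  #|[set y : 'cV[Zmod c]_n | redmx c (diagz m n e) *m y == 0]| =
  (\prod_(k < n) gcdn (e k) c)%N.
Proof.
move=> e0; under eq_bigr => k _ do rewrite -(card_Zmod_ann c_gt0).
rewrite -card_cV_family; apply: eq_card => y; rewrite !inE.
have mulE (i : 'I_m) (k : 'I_n) : i = k :> nat ->
    (redmx c (diagz m n e) *m y) i 0 = (e k)%:R * y k 0.
  move=> ik; rewrite mxE (bigD1 k) //= big1 => [|j jk].
    by rewrite addr0 !mxE ik eqxx mulr1n -pmulrn.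
  by rewrite !mxE ik eq_sym (inj_eq val_inj) (negbTE jk) mulr0z mul0r.
apply/eqP/forallP => [/matrixP My k|ey].
  rewrite inE; have [lt_km|/e0->] := ltnP k m; last by rewrite mul0r.
  by rewrite -(mulE (Ordinal lt_km)) // My mxE.
apply/matrixP => i j; rewrite ord1 [RHS]mxE; have [lt_in|le_ni] := ltnP i n.
  by rewrite (mulE i (Ordinal lt_in)) //; apply/eqP; have := ey (Ordinal lt_in).
rewrite mxE big1 // => k _; rewrite !mxE; case: eqP => [ik|_].
  by move: le_ni; rewrite ik leqNgt ltn_ord.
by rewrite mulr0z mul0r.
Qed.

Lemma card_kernel_unit m n (L : 'M[int]_m) (R : 'M[int]_n)
    (M : 'M[int]_(m, n)) : L \in unitmx -> R \in unitmx ->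
  #|[set y : 'cV[Zmod c]_n | redmx c (L *m M *m R) *m y == 0]| =
  #|[set y : 'cV[Zmod c]_n | redmx c M *m y == 0]|.
Proof.
move=> uL uR.
have redK k (V : 'M[int]_k) : V \in unitmx ->
    (redmx c (invmx V) *m redmx c V = 1%:M) *
    (redmx c V *m redmx c (invmx V) = 1%:M).
  by move=> uV; rewrite -!redmxM mulVmx // mulmxV // redmx1.
have inj_R : injective (mulmx (redmx c R) : 'cV_n -> 'cV_n).
  apply: (can_inj (g := mulmx (redmx c (invmx R)))) => y.
  by rewrite mulmxA redK // mul1mx.
rewrite -(card_imset _ inj_R); apply: eq_card => y; rewrite inE.
apply/imsetP/idP => [[x]|/eqP My]; rewrite ?inE.
  rewrite !redmxM => /eqP Mx ->.
  move: Mx => /(congr1 (mulmx (redmx c (invmx L)))).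
  by rewrite mulmx0 -!mulmxA (mulmxA (redmx c (invmx L))) redK // mul1mx => /eqP.
exists (redmx c (invmx R) *m y); last by rewrite mulmxA redK // mul1mx.
by rewrite inE !redmxM -!mulmxA (mulmxA (redmx c R)) redK // mul1mx My mulmx0.
Qed.

Lemma invariant_factor_oversize m n (M : 'M[int]_(m, n)) k :
  (m <= k)%N -> invariant_factor M k.+1 = 0%N.
Proof.
move=> le_mk; apply/eqP.
by rewrite invariant_factor_eq0 (leq_trans (rank_leq_row _)).
Qed.

Lemma card_kernel m n (M : 'M[int]_(m, n)) :
  #|[set y : 'cV[Zmod c]_n | redmx c M *m y == 0]| =
  (\prod_(k < n) gcdn (invariant_factor M k.+1) c)%N.
Proof.
have [L [R [uL uR {1}->]]] := smith_normal_form M.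
rewrite card_kernel_unit // card_kernel_diagz //.
exact: invariant_factor_oversize.
Qed.

(** Left kernels of [M] and of [row_mx M v] live in the same module, which is what makes the two
    matrices comparable in [solvable_mod_gcdn]. *)
Lemma card_left_kernel m n (M : 'M[int]_(m, n)) :
  #|[set u : 'cV[Zmod c]_m | redmx c M^T *m u == 0]| =
  (\prod_(k < m) gcdn (invariant_factor M k.+1) c)%N.
Proof.
have [L [R [uL uR {1}->]]] := smith_normal_form M.
rewrite !trmx_mul mulmxA card_kernel_unit ?unitmx_tr //.
have -> e : (diagz m n e)^T = diagz n m e.
  by apply/matrixP => i j; rewrite !mxE eq_sym; case: eqP => // ->.
rewrite card_kernel_diagz // => k le_nk; apply/eqP.
by rewrite invariant_factor_eq0 (leq_trans (rank_leq_col _)).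
Qed.
End Kernel.

(** * Solvability modulo c and its transfer between moduli *)

(** The products are compared at the modulus [c' = gcdn (f k) c]. Before [k] the factors agree; from
    [k] on [c'] divides [f i], so the factor of [f] has its largest possible value [c']. Equal
    products then force [c'] to divide [e k]. *)
Lemma prod_gcdn_chain_dvd (p c k : nat) (e f : nat -> nat) :
  (0 < c)%N -> (k < p)%N ->
  (forall i j, (i <= j)%N -> (f i %| f j)%N) ->
  (forall c', (c' %| c)%N ->
     \prod_(i < p) gcdn (e i) c' = \prod_(i < p) gcdn (f i) c')%N ->
  (forall i, (i < k)%N -> gcdn (e i) c = gcdn (f i) c) ->
  (gcdn (f k) c %| gcdn (e k) c)%N.
Proof.
move=> c_gt0 lt_kp f_dvd prod_eq eq_lt; set c' := gcdn (f k) c.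
have c'_gt0 : (0 < c')%N by rewrite gcdn_gt0 c_gt0 orbT.
have c'_dvd : (c' %| c)%N by rewrite dvdn_gcdr.
have gcd_gt0 h : (0 < gcdn h c')%N by rewrite gcdn_gt0 c'_gt0 orbT.
have le_gcd (i : 'I_p) : (gcdn (e i) c' <= gcdn (f i) c')%N.
  have [lt_ik|le_ki] := ltnP i k.
    by rewrite -(gcdn_idPr c'_dvd) gcdnA eq_lt // -gcdnA.
  rewrite (gcdn_idPr (_ : c' %| f i)%N); first exact/dvdn_leq/dvdn_gcdr.
  exact: dvdn_trans (dvdn_gcdl _ _) (f_dvd _ _ le_ki).
rewrite dvdn_gcd c'_dvd andbT; apply/gcdn_idPr/eqP; rewrite eqn_leq.
rewrite (dvdn_leq c'_gt0 (dvdn_gcdr _ _)) leqNgt /=; apply/negP => lt_e.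
have prodE := prod_eq c' c'_dvd.
rewrite [LHS](bigD1 (Ordinal lt_kp)) // in prodE.
rewrite [RHS](bigD1 (Ordinal lt_kp)) //= in prodE.
suff: (gcdn (e k) c' * \prod_(i < p | i != Ordinal lt_kp) gcdn (e i) c' <
       gcdn (f k) c' * \prod_(i < p | i != Ordinal lt_kp) gcdn (f i) c')%N.
  by rewrite prodE ltnn.
rewrite (gcdn_idPr (_ : c' %| f k)%N) ?dvdn_gcdl //.
apply: leq_ltn_trans (leq_mul (leqnn _) (leq_prod (fun i _ => le_gcd i))) _.
by rewrite ltn_pmul2r ?prodn_gt0.
Qed.

Lemma prod_gcdn_chain (p c k : nat) (e f : nat -> nat) :
  (0 < c)%N -> (k < p)%N ->
  (forall i j, (i <= j)%N -> (e i %| e j)%N) ->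
  (forall i j, (i <= j)%N -> (f i %| f j)%N) ->
  (forall c', (c' %| c)%N ->
     \prod_(i < p) gcdn (e i) c' = \prod_(i < p) gcdn (f i) c')%N ->
  gcdn (e k) c = gcdn (f k) c.
Proof.
move=> c_gt0 + e_dvd f_dvd prod_eq; have [i] := ubnP k; elim: i k => // i IHi k.
move=> le_ki lt_kp; have IHk l : (l < k)%N -> gcdn (e l) c = gcdn (f l) c.
  move=> lt_lk; apply: IHi; first exact: leq_trans lt_lk le_ki.
  exact: ltn_trans lt_lk lt_kp.
apply/eqP; rewrite eqn_dvd; apply/andP; split.
  by apply: (@prod_gcdn_chain_dvd p) => // [c'|l] => [/prod_eq->|/IHk->].
exact: (@prod_gcdn_chain_dvd p).
Qed.

(** Stated over the integers, so that one system can be followed from one modulus to another. *)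
Definition solvable_mod (c p n : nat) (M : 'M[int]_(p, n)) (v : 'cV[int]_p) :
    Prop :=
  exists x : 'cV[int]_n, exists y : 'cV[int]_p, v = M *m x + c%:Z *: y.

Section SolvableMod.
Variables (p n : nat) (M : 'M[int]_(p, n)) (v : 'cV[int]_p).

Lemma Colq_solvable_mod q : (0 < q)%N ->
  redmx q v \in Colq q M -> solvable_mod q M v.
Proof.
move=> q_gt0 /imsetP[x _ vE]; pose x' : 'cV[int]_n := \col_k (val (x k))%:Z.
exists x', (\col_i ((v - M *m x') i ord0 %/ q%:Z)%Z); apply/eqP.
rewrite addrC -subr_eq; apply/eqP/matrixP => i j; rewrite ord1.
rewrite [RHS]mxE [(\col__ _) _ _]mxE mulrC divzK // -Zmod_intr_eq0 // mxE.
rewrite rmorphD /= [X in _ + X]/= !mxE rmorphN /= rmorph_sum /= subr_eq0.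
have /matrixP/(_ i 0) := vE; rewrite !mxE summxE => ->.
apply/eqP/eq_bigr => k _.
by rewrite !mxE rmorphM /= -pmulrn Zmod_natr_id // mulrC.
Qed.

Lemma solvable_mod_dvd c c' : (c' %| c)%N ->
  solvable_mod c M v -> solvable_mod c' M v.
Proof.
case/dvdnP=> k ->; case=> x [y ->]; exists x, (k%:Z *: y).
by rewrite scalerA mulrC -PoszM.
Qed.

(** Modulo any divisor of [c], [v] is a combination of the columns of [M], so [M] and [row_mx M v]
    have the same left kernel. Equal kernel sizes at all these divisors determine the single gcds by
    [prod_gcdn_chain]. *)
Lemma solvable_mod_gcdn c k : (0 < c)%N -> (k < p)%N -> solvable_mod c M v ->
  gcdn (invariant_factor M k.+1) c =
  gcdn (invariant_factor (row_mx M v) k.+1) c.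
Proof.
move=> c_gt0 lt_kp sol.
pose e i := invariant_factor M i.+1.
pose f i := invariant_factor (row_mx M v) i.+1.
apply: (@prod_gcdn_chain p c k e f) => //; [exact: invariant_factor_dvd..|].
move=> c' c'_dvd; have c'_gt0 := dvdn_gt0 c_gt0 c'_dvd.
have [x [y vE]] := solvable_mod_dvd c'_dvd sol.
rewrite -!card_left_kernel //; apply: eq_card => u; rewrite !inE.
rewrite tr_row_mx /redmx map_col_mx mul_col_mx col_mx_eq0.
rewrite andb_idr // => /eqP Mu; rewrite vE linearD linearZ /= trmx_mul.
rewrite map_mxD map_mxM mulmxDl -mulmxA Mu mulmx0 add0r map_mxZ.
have c'0 : c'%:Z%:~R = 0 :> Zmod c' by apply/eqP; rewrite Zmod_intr_eq0.
by rewrite /= c'0 scale0r mul0mx.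
Qed.
End SolvableMod.

Lemma diagz_mul m n p (e f : nat -> nat) :
  (forall k, (n <= k)%N -> e k = 0%N) ->
  diagz m n e *m diagz n p f = diagz m p (fun i => e i * f i)%N.
Proof.
move=> e0; apply/matrixP => i j; rewrite !mxE; have [lt_in|le_ni] := ltnP i n.
  rewrite (bigD1 (Ordinal lt_in)) //= big1 => [|k]; last first.
    by rewrite -(inj_eq val_inj) /= !mxE eq_sym => /negbTE->; rewrite mul0r.
  rewrite !mxE /= eqxx addr0 mulr1n.
  by case: eqP => _; rewrite ?mulr0 // !mulr1n PoszM.
rewrite e0 // mul0n mul0rn big1 // => k _; rewrite mxE e0 // mul0rn mul0r //.
Qed.

(** All invariant factors divide the last one [d], so in Smith coordinates the diagonal of the
    quotients [d %/ e i] serves; past the rank [e i] is 0 and both sides vanish. *)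
Lemma quasi_inverse m n (M : 'M[int]_(m, n)) :
  exists G : 'M[int]_(n, m),
    M *m G *m M = (invariant_factor M (rankQ M))%:Z *: M.
Proof.
have [L [R [uL uR defM]]] := smith_normal_form M.
set r := rankQ M; set d := invariant_factor M r.
pose e i := invariant_factor M i.+1.
have e_eq0 k : (r <= k)%N -> e k = 0%N.
  by move=> le_rk; apply/eqP; rewrite invariant_factor_eq0.
pose G0 := diagz n m (fun i => d %/ e i)%N.
have DGD : diagz m n e *m G0 *m diagz m n e = d%:Z *: diagz m n e.
  rewrite !diagz_mul => [|k le_mk|k le_nk].
  - apply/matrixP => i j; rewrite !mxE mulrnAr -PoszM; congr (Posz _ *+ _).
    have [lt_ir|/e_eq0->] := ltnP i r; last by rewrite !muln0.
    rewrite [(e i * _)%N]mulnC divnK // /d; case: (r) lt_ir => // r' lt_ir.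
    exact: invariant_factor_dvd.
  - by rewrite e_eq0 ?mul0n // (leq_trans (rank_leq_row _)).
  - by rewrite e_eq0 // (leq_trans (rank_leq_col _)).
exists (invmx R *m G0 *m invmx L); rewrite [in RHS]defM [X in X *m _ *m X]defM.
rewrite !mulmxA mulmxK // mulmxKV // -(mulmxA L) -(mulmxA L) DGD.
by rewrite -scalemxAr -scalemxAl.
Qed.

(** The Rouché-Capelli criterion, transposed because [submx] compares row spaces. *)
Lemma solvable_rank (F : fieldType) m n (M : 'M[F]_(m, n)) (v : 'cV[F]_m) :
  (exists x, M *m x = v) <-> \rank (row_mx M v) = \rank M.
Proof.
rewrite -(mxrank_tr M) -(mxrank_tr (row_mx M v)) tr_row_mx -addsmxE.
have sM : (M^T <= M^T + v^T)%MS by exact: addsmxSl.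
split=> [[x vE]|/esym/eqP].
  apply/esym/eqP; rewrite (mxrank_leqif_sup sM).2 addsmx_sub submx_refl.
  by rewrite -vE trmx_mul submxMl.
rewrite (mxrank_leqif_sup sM).2 addsmx_sub => /andP[_ /submxP[D vE]].
by exists D^T; apply: trmx_inj; rewrite trmx_mul trmxK.
Qed.

Lemma map_intr_mx_inj m n :
  injective (map_mx intr : 'M[int]_(m, n) -> 'M[rat]_(m, n)).
Proof.
move=> M N /matrixP MN; apply/matrixP => i j; apply: (@intr_inj rat).
by move: (MN i j); rewrite !mxE.
Qed.

Section Lift.
Variables (p n : nat) (M : 'M[int]_(p, n)) (v : 'cV[int]_p).
Hypothesis consistent : rankQ (row_mx M v) = rankQ M.

(** Write [v = M x + g y] with [g = gcdn c d]. Rational consistency gives [M G v = d v]; cancelling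
    [g] gives [M G y = d y], so [d y] lies in the image of [M]. A Bezout relation [g = u c + w d]
    then turns [g y] into an element of that image plus a multiple of [c]. *)
Lemma solvable_mod_lift q c : (0 < c)%N ->
  (gcdn c (invariant_factor M (rankQ M)) %| q)%N ->
  solvable_mod q M v -> solvable_mod c M v.
Proof.
have [G MGM] := quasi_inverse M; set d := invariant_factor _ _ in MGM *.
set g := gcdn c d; move=> c_gt0 g_dvd /(solvable_mod_dvd g_dvd)[x [y vE]].
have g_gt0 : (0 < g)%N by rewrite gcdn_gt0 c_gt0.
have MGv : M *m G *m v = d%:Z *: v.
  have [z Mz] : exists z : 'cV[rat]_n, map_mx intr M *m z = map_mx intr v.
    by apply/solvable_rank; rewrite -map_row_mx.
  apply: map_intr_mx_inj.
  rewrite map_mxM map_mxZ -Mz mulmxA -!map_mxM MGM map_mxZ.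
  by rewrite scalemxAl.
have MGy : M *m G *m y = d%:Z *: y.
  have : g%:Z *: (M *m G *m y) = g%:Z *: (d%:Z *: y).
    have yE : g%:Z *: y = v - M *m x by rewrite vE addrC addKr.
    rewrite scalemxAr yE mulmxBr MGv mulmxA MGM -scalemxAl -scalerBr -yE.
    by rewrite !scalerA mulrC.
  move=> /matrixP gE; apply/matrixP => i j; apply: (@mulfI _ g%:Z).
    by rewrite eqz_nat -lt0n.
  by have := gE i j; rewrite mxE [RHS]mxE.
have [u [w uw]] := Bezoutz c%:Z d%:Z.
exists (x + w *: (G *m y)), (u *: y).
rewrite mulmxDr -scalemxAr mulmxA MGy -addrA {1}vE; congr (_ + _).
rewrite !scalerA -scalerDl; congr (_ *: y).
by rewrite -[LHS]/(gcdz c d) -uw addrC [c%:Z * u]mulrC.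
Qed.
End Lift.

(* In the coordinates of [lattice_coordinates] below, the vectors whose entries
   from [j] on vanish are the homomorphisms to [Z/c] of a saturated lattice of
   rank [j]. *)
Definition truncated (c n j : nat) : {set 'cV[Zmod c]_n} :=
  [set y : 'cV[Zmod c]_n | [forall k : 'I_n, (j <= k)%N ==> (y k 0 == 0)]]%SET.

Definition zero_rows (c m n : nat) (B : 'M[int]_(m, n)) (y : 'cV[Zmod c]_n) :
    {set 'I_m} :=
  [set i | (redmx c B *m y) i 0 == 0]%SET.

(** * Kernels restricted to the first j coordinates *)

Section Truncation.
Variables (c n j : nat).
Hypotheses (c_gt0 : (0 < c)%N) (le_jn : (j <= n)%N).

Lemma prod_tail (F : nat -> nat) : (forall k, (j <= k)%N -> F k = c) ->
  (\prod_(k < n) F k = \prod_(k < j) F k * c ^ (n - j))%N.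
Proof.
move=> Fc; rewrite -!(big_mkord xpredT F) (big_cat_nat (leq0n j) le_jn) /=.
congr (_ * _)%N; rewrite big_nat_cond (eq_bigr (fun _ => c)); last first.
  by move=> k /andP[/andP[/Fc]].
by rewrite -big_nat_cond prod_nat_const_nat.
Qed.

(** The kernel is the direct sum of its truncated part and of [W], the vectors supported on the
    coordinates from [j] on, which [P] does not see. *)
Lemma card_truncated_kernel p (P : 'M[int]_(p, n)) :
  (forall i (k : 'I_n), (j <= k)%N -> P i k = 0) ->
  (#|[set y in truncated c n j | (redmx c P *m y == 0)%R]| * c ^ (n - j))%N =
  #|[set y : 'cV[Zmod c]_n | redmx c P *m y == 0]|.
Proof.
move=> P0; pose W := [set w : 'cV[Zmod c]_n |
  [forall k : 'I_n, w k 0 \in if (k < j)%N then pred1 0 else predT]].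
have cardW : #|W| = (c ^ (n - j))%N.
  pose F k := #|if (k < j)%N then pred1 (0 : Zmod c) else predT|.
  rewrite card_cV_family (prod_tail (F := F)) => [|k le_jk]; last first.
    by rewrite /F ltnNge le_jk /= card_Zmod.
  by rewrite big1 ?mul1n // => k _; rewrite /F ltn_ord card1.
have PW w : w \in W -> redmx c P *m w = 0.
  rewrite inE => /forallP Ww; apply/matrixP => i l.
  rewrite ord1 !mxE big1 // => k _; have := Ww k.
  case: ltnP => [_|le_jk _]; last by rewrite mxE P0 // mul0r.
  by rewrite inE => /eqP->; rewrite mulr0.
rewrite -cardW -cardsX -[LHS](card_in_imset (f := fun u => u.1 + u.2)); last first.
  move=> [y w] [y' w'] /setXP[/setIdP[Ty _] Ww] /setXP[/setIdP[Ty' _] Ww'] /=.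
  move=> E; suff yy : y = y' by move: E; rewrite yy => /addrI->.
  move: Ty Ty' Ww Ww'; rewrite !inE.
  move=> /forallP Ty /forallP Ty' /forallP Ww /forallP Ww'.
  apply/matrixP => k l; rewrite ord1; have /matrixP/(_ k 0) := E; rewrite !mxE.
  have := Ww k; have := Ww' k; have := Ty k; have := Ty' k.
  case: ltnP => [_ _ _|_ /eqP-> /eqP-> //].
  by rewrite !inE => /eqP-> /eqP->; rewrite !addr0.
apply: eq_card => y; rewrite [RHS]inE; apply/imsetP/eqP => [[[z w]]|Py].
  by case/setXP=> /setIdP[_ /eqP Pz] /= Ww ->; rewrite mulmxDr Pz PW // addr0.
pose z : 'cV[Zmod c]_n := \col_k (if (k < j)%N then y k 0 else 0).
have Wyz : y - z \in W.
  rewrite inE; apply/forallP => k; rewrite !mxE; case: ltnP => // _.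
  by rewrite inE subrr.
exists (z, y - z); last by rewrite addrC subrK.
rewrite inE /= Wyz andbT inE -[z](subKr y) mulmxBr Py PW // subr0 eqxx andbT.
rewrite subKr inE; apply/forallP => k; apply/implyP => le_jk.
by rewrite mxE ltnNge le_jk.
Qed.
End Truncation.

Lemma rowsof_mulmx m n p (A : 'M[int]_(m, n)) (U : 'M[int]_(n, p)) J :
  rowsof A J *m U = rowsof (A *m U) J.
Proof. exact: mul_rowsub_mx. Qed.

Lemma rowsof_kernel c m n (B : 'M[int]_(m, n)) J (y : 'cV[Zmod c]_n) :
  (redmx c (rowsof B J) *m y == 0) = (J \subset zero_rows B y).
Proof.
have rowE k : (redmx c (rowsof B J) *m y) k 0 = (redmx c B *m y) (enum_val k) 0.
  by rewrite !mxE; apply: eq_bigr => l _; rewrite !mxE.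
apply/eqP/subsetP => [/matrixP yJ i iJ|yJ].
  by rewrite inE -[i](enum_rankK_in iJ) // -rowE yJ mxE.
apply/matrixP => k l; rewrite ord1 rowE [RHS]mxE; apply/eqP.
by have := yJ _ (enum_valP k); rewrite inE.
Qed.

(** * Saturated lattices of row sets and the contribution of one flat *)

Section RowMatroid.
Variables (m n : nat) (A : 'M[int]_(m, n)).
Implicit Types (J X : {set 'I_m}) (c j : nat).

Lemma rkE J :
  rk A J = \rank (rowsub (fun k : 'I_#|J| => enum_val k)
                         (map_mx intr A : 'M[rat]_(m, n))).
Proof. by rewrite /rk /rankQ map_mxsub. Qed.

Lemma rk_matroid : matroid_rank (rk A).
Proof.
have [r_unit r_clos] := rank_rowsub_matroid (map_mx intr A : 'M[rat]_(m, n)).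
by split=> [e J|e J K]; rewrite !rkE; [apply: r_unit | apply: r_clos].
Qed.

Lemma rk_set0 : rk A set0 = 0%N.
Proof. by apply/eqP; rewrite -leqn0 -(cards0 'I_m) rank_leq_row. Qed.

Lemma rk_leq_card J : (rk A J <= #|J|)%N.
Proof. exact: rank_leq_row. Qed.

Lemma rk_leq_n J : (rk A J <= n)%N.
Proof. exact: rank_leq_col. Qed.

Lemma rk_setT : rk A setT = rankQ A.
Proof.
rewrite rkE; apply/eqP; rewrite eqn_leq !mxrankS //; last first.
  by apply/rowsub_enum_subP => i _; exact: row_sub.
by apply/row_subP => i; exact: row_rowsub_enum.
Qed.

Lemma rk_set1_neq0 i : row i A != 0 -> rk A [set i] != 0%N.
Proof.
apply: contra; rewrite rkE mxrank_eq0 => /eqP A0.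
have := row_rowsub_enum (map_mx intr A : 'M[rat]_(m, n)) (set11 i).
rewrite A0 => /submxP[D]; rewrite mulmx0 -map_row => /matrixP r0.
apply/eqP/matrixP => k l.
by apply: (@intr_inj rat); move: (r0 k l); rewrite !mxE.
Qed.

(* The first [rk A X] rows of [U^-1] form a basis of the lattice of integer points
   in the span of the rows of [A] indexed by [X]. *)
Lemma lattice_coordinates X : exists2 U : 'M[int]_n, U \in unitmx &
  forall i (k : 'I_n), i \in X -> (rk A X <= k)%N -> (A *m U) i k = 0.
Proof.
have [L [R [uL uR XE]]] := smith_normal_form (rowsof A X).
exists (invmx R) => [|i k iX le_k]; first by rewrite unitmx_inv.
have -> : (A *m invmx R) i k = (rowsof A X *m invmx R) (enum_rank_in iX i) k.
  by rewrite rowsof_mulmx [RHS]mxE enum_rankK_in.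
rewrite [in LHS]XE mulmxK // mxE big1 // => l _; rewrite mxE.
case: eqP => [lk|_]; last by rewrite mulr0n mulr0.
have /eqP-> : invariant_factor (rowsof A X) l.+1 == 0%N.
  by rewrite invariant_factor_eq0 lk.
by rewrite mul0rn mulr0.
Qed.

(** After multiplication by [c ^ (n - rk A X)] both sides count the kernel of the rows of [J] modulo
    [c]: on the left the invariant factors past the rank supply the power of [c], on the right the
    truncated coordinates do. *)
Lemma card_torsion X U c J : (0 < c)%N -> U \in unitmx ->
  (forall i (k : 'I_n), i \in X -> (rk A X <= k)%N -> (A *m U) i k = 0) ->
  J \subset X -> rk A J = rk A X ->
  (\prod_(k < rk A J) gcdn (dinv A J k.+1) c)%N =
  #|[set y in truncated c n (rk A X) | J \subset zero_rows (A *m U) y]|.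
Proof.
move=> c_gt0 uU U0 sJX rJX.
have cpow_gt0 : (0 < c ^ (n - rk A X))%N by rewrite expn_gt0 c_gt0.
apply/eqP; rewrite -(eqn_pmul2r cpow_gt0); apply/eqP.
rewrite rJX -(prod_tail (rk_leq_n X) (F := fun k => gcdn (dinv A J k.+1) c)).
  rewrite -(card_kernel c_gt0 (rowsof A J)).
  rewrite -(card_kernel_unit c (rowsof A J) (unitmx1 _ _) uU) mul1mx.
  rewrite rowsof_mulmx -(card_truncated_kernel c_gt0 (rk_leq_n X)).
    by congr (_ * _)%N; apply: eq_card => y; rewrite !inE rowsof_kernel.
  move=> i k le_k; rewrite mxE U0 //; exact: (subsetP sJX _ (enum_valP i)).
move=> k le_k; rewrite /dinv (eqP (_ : invariant_factor _ _ == 0%N)) ?gcd0n //.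
by rewrite invariant_factor_eq0 -/(rk A J) rJX.
Qed.

(* Contribution of the subsets of [X] of full rank to [beta j c], [j] being
   the rank of [X]. *)
Definition flat_sum X c : int :=
  (-1) ^+ rk A X *
  \sum_(J : {set 'I_m} | (J \subset X) && (rk A J == rk A X))
     (-1) ^+ #|J| * (\prod_(k < rk A J) gcdn (dinv A J k.+1) c)%N%:Z.

(** The [T(E)] of the overview; it is 0 when [E] does not span [X], as then no subset of [E]
    does. *)
Definition spanning_sum X (E : {set 'I_m}) : int :=
  rank_sum (rk A) set0 E *+ (rk A E == rk A X).

Lemma spanning_sum_ge0 X E : 0 <= spanning_sum X E.
Proof. by rewrite mulrn_wge0 // rank_sum_ge0 //; exact: rk_matroid. Qed.

Lemma flat_sumE X U c : (0 < c)%N -> U \in unitmx ->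
  (forall i (k : 'I_n), i \in X -> (rk A X <= k)%N -> (A *m U) i k = 0) ->
  flat_sum X c = \sum_(y in truncated c n (rk A X))
                    spanning_sum X (X :&: zero_rows (A *m U) y).
Proof.
move=> c_gt0 uU U0; rewrite /flat_sum.
set T := truncated c n (rk A X).
pose Z (y : 'cV[Zmod c]_n) := zero_rows (A *m U) y.
rewrite (eq_bigr (fun J => \sum_(y in T | J \subset Z y) (-1) ^+ #|J|));
    last first.
  move=> J /andP[sJX /eqP rJX]; rewrite (card_torsion c_gt0 uU U0 sJX rJX).
  by rewrite sumr_const -mulr_natr cardsE natz.
rewrite (exchange_big_dep (fun y => y \in T)) //=; last first.
  by move=> J y _ /andP[].
rewrite mulr_sumr; apply: eq_bigr => y Ty; set E := X :&: _.
rewrite /spanning_sum /rank_sum !setU0 rk_set0 subn0.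
have cond J :
    [&& (J \subset X) && (rk A J == rk A X), y \in T & J \subset Z y] =
    (J \subset E) && (rk A J == rk A X).
  by rewrite Ty /E subsetI /= -!andbA; congr (_ && _); rewrite andbC.
rewrite (eq_bigl _ _ cond); case: eqP => [rE|rE]; rewrite ?mulr1n ?mulr0n.
  by rewrite rE; under [in RHS]eq_bigl => J do rewrite setU0.
rewrite big1 ?mulr0 // => J /andP[sJE /eqP rJ]; case: rE; apply/eqP.
rewrite eqn_leq (rank_subset rk_matroid (subsetIl _ _)) -rJ /=.
exact: (rank_subset rk_matroid sJE).
Qed.

Lemma flat_sum_ge0 X c : (0 < c)%N -> 0 <= flat_sum X c.
Proof.
move=> c_gt0; have [U uU U0] := lattice_coordinates X.
by rewrite (flat_sumE c_gt0 uU U0) sumr_ge0 // => y _; exact: spanning_sum_ge0.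
Qed.

Lemma flat_sum1 X : flat_sum X 1 = rank_sum (rk A) set0 X.
Proof.
rewrite /flat_sum /rank_sum !setU0 rk_set0 subn0; congr (_ * _).
apply: eq_big => [J|J _]; first by rewrite setU0.
by rewrite big1 ?mulr1 // => k _; rewrite gcdn1.
Qed.

Lemma flat_sum1_gt0 X : (forall i, row i A != 0) -> 0 < flat_sum X 1.
Proof.
move=> nzA; rewrite flat_sum1; apply: rank_sum_gt0; first exact: rk_matroid.
by move=> i _; rewrite setU0 rk_set0 rk_set1_neq0.
Qed.

Lemma flat_sum_le X a b : (0 < b)%N -> (a %| b)%N ->
  flat_sum X a <= flat_sum X b.
Proof.
move=> b_gt0 /dvdnP[t bE].
have [t_gt0 a_gt0] : (0 < t)%N /\ (0 < a)%N.
  by apply/andP; rewrite -muln_gt0 -bE.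
have [U uU U0] := lattice_coordinates X; set B := A *m U in U0.
rewrite (flat_sumE a_gt0 uU U0) (flat_sumE b_gt0 uU U0) -/B.
(* As [b = t * a], multiplication by [t] embeds Z/a into Z/b. *)
pose h (y : 'cV[Zmod a]_n) : 'cV[Zmod b]_n := \col_k (t * val (y k 0))%:R.
have natE (x : Zmod a) : val ((t * val x)%:R : Zmod b) = (t * val x)%N.
  by rewrite Zmod_natr_val // modn_small // bE ltn_pmul2l // Zmod_ltn.
have inj_h : injective h.
  move=> y z /matrixP yz; apply/matrixP => k l; rewrite ord1.
  have /(congr1 val) := yz k 0; rewrite !mxE !natE => /eqP.
  by rewrite eqn_pmul2l // => /eqP/val_inj.
(* On integer representatives: [a] divides an integer exactly when [t * a] divides [t] times it. *)
have zero_h y : zero_rows B (h y) = zero_rows B y.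
  have intE c (c_gt0 : (0 < c)%N) (x : 'cV[int]_n) i :
      (i \in zero_rows B (redmx c x)) = (c %| (B *m x) i ord0)%Z.
    rewrite inE /redmx -map_mxM mxE; exact: Zmod_intr_eq0.
  pose x : 'cV[int]_n := \col_k (val (y k 0))%:Z.
  have -> : h y = redmx b (t%:Z *: x).
    by apply/matrixP => k l; rewrite ord1 !mxE -PoszM -pmulrn.
  have -> : y = redmx a x.
    by apply/matrixP => k l; rewrite ord1 !mxE -pmulrn Zmod_natr_id.
  apply/setP => i; rewrite !intE // -scalemxAr mxE bE PoszM dvdz_mul2l //.
  by rewrite eqz_nat -lt0n.
set Ta := truncated a n _; set Tb := truncated b n _.
have truncated_h y : y \in Ta -> h y \in Tb.
  rewrite !inE => /forallP Ty; apply/forallP => k; apply/implyP => le_k.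
  by have := Ty k; rewrite le_k mxE => /eqP->; rewrite muln0.
pose F (y : 'cV[Zmod b]_n) := spanning_sum X (X :&: zero_rows B y).
rewrite (eq_bigr (F \o h)) => [|y _]; last by rewrite /= /F zero_h.
rewrite -(big_imset F (in2W inj_h)) /= [leRHS](bigID [in h @: Ta]) /=.
rewrite [X in _ <= X + _](_ : _ = \sum_(y in h @: Ta) F y).
  by rewrite lerDl sumr_ge0 // => y _; exact: spanning_sum_ge0.
apply: eq_bigl => y; rewrite andbC; apply: andb_idr => /imsetP[z Tz ->].
exact: truncated_h.
Qed.
End RowMatroid.

(** * Closures in the augmented matroid and the sum over flats *)

Section Affine.
Variables (m n : nat) (A : 'M[int]_(m, n)) (av : 'cV[int]_m).
Implicit Types (J X : {set 'I_m}) (c j : nat).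

Lemma augmentedE J : augmented A av J = rowsof (row_mx A av) J.
Proof. by apply/matrixP => i k; rewrite !mxE; case: split => l; rewrite mxE. Qed.

Lemma rkbarE J : rkbar A av J = rk (row_mx A av) J.
Proof. by rewrite /rkbar augmentedE. Qed.

Lemma rkbar_matroid : matroid_rank (rkbar A av).
Proof.
have [r_unit r_clos] := rk_matroid (row_mx A av).
by split=> [e J|e J K]; rewrite !rkbarE; [apply: r_unit | apply: r_clos].
Qed.

Lemma rk_leq_rkbar J : (rk A J <= rkbar A av J)%N.
Proof.
rewrite /rk /rkbar /rankQ /augmented map_row_mx.
set B := map_mx intr (rowsof A J); set b := map_mx intr (rowsof av J).
have {1}-> : B = row_mx B b *m col_mx 1%:M 0.
  by rewrite mul_row_col mulmx1 mulmx0 addr0.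
exact: mxrankM_maxl.
Qed.

Lemma consistent_subset J X : rkbar A av X = rk A X -> J \subset X ->
  rk A J = rk A X -> rkbar A av J = rk A J.
Proof.
move=> cX sJX rJ; apply/eqP; rewrite eqn_leq rk_leq_rkbar andbT rJ -cX.
exact: rank_subset rkbar_matroid _ _ sJX.
Qed.

Definition closure J : {set 'I_m} :=
  [set i | rkbar A av (i |: J) == rkbar A av J].

Lemma sub_closure J : J \subset closure J.
Proof. by apply/subsetP => i iJ; rewrite inE (setUidPr _) ?sub1set. Qed.

Lemma rkbar_closure J : rkbar A av (closure J) = rkbar A av J.
Proof.
rewrite -[in LHS](setUidPl (sub_closure J)).
by apply: rank_closure rkbar_matroid _ _ _ => i; rewrite inE => /eqP.
Qed.

Lemma closure_closed J : closure (closure J) = closure J.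
Proof.
apply/eqP; rewrite eqEsubset sub_closure andbT; apply/subsetP => i.
rewrite !inE rkbar_closure => /eqP ri.
rewrite eqn_leq (rank_setU rkbar_matroid) andbT -ri.
by rewrite (rank_subset rkbar_matroid) // setUS ?sub_closure.
Qed.

Lemma rk_closure J : rkbar A av J = rk A J -> rk A (closure J) = rk A J.
Proof.
move=> cJ; apply/eqP; rewrite eqn_leq -{1}cJ -rkbar_closure rk_leq_rkbar.
exact: rank_subset (rk_matroid A) _ _ (sub_closure J).
Qed.

(** These sets correspond to the nonempty intersections of codimension [j], each given by all the
    hyperplanes that contain it. *)
Definition affine_flat j X : bool :=
  [&& rkbar A av X == rk A X, rk A X == j & closure X == X].

(** Every full-rank subset of a consistent flat is consistent and spans it, so the group of sets
    with closure [X] no longer refers to the augmented matrix. *)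
Lemma closure_eq j X J : affine_flat j X ->
  (rkbar A av J == rk A J) && (rk A J == j) && (closure J == X) =
  (J \subset X) && (rk A J == rk A X).
Proof.
case/and3P=> /eqP cX /eqP rX /eqP clX; apply/idP/idP.
  case/andP=> /andP[_ /eqP rJ] /eqP clJ.
  by rewrite -{1}clJ sub_closure rJ rX eqxx.
case/andP=> sJX /eqP rJ; have cJ := consistent_subset cX sJX rJ.
rewrite cJ rJ rX !eqxx /= eqEsubset; apply/andP; split; apply/subsetP => i.
  rewrite inE => /eqP ri; rewrite -clX inE; apply/eqP.
  exact: rkbar_matroid.2 _ _ _ sJX ri.
move=> iX; rewrite inE eqn_leq (rank_setU rkbar_matroid) andbT.
by rewrite cJ rJ -cX (rank_subset rkbar_matroid) // subUset sub1set iX.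
Qed.

(** [beta] with the test in [dtilde] left out; the two agree where all consistent systems are
    solvable modulo [c]. *)
Definition torsion_sum j c : int :=
  (-1) ^+ j * \sum_(J : {set 'I_m} | (rkbar A av J == rk A J) && (rk A J == j))
     (-1) ^+ #|J| * (\prod_(k < rk A J) gcdn (dinv A J k.+1) c)%N%:Z.

Lemma torsion_sumE j c :
  torsion_sum j c = \sum_(X | affine_flat j X) flat_sum A X c.
Proof.
rewrite /torsion_sum (partition_big closure (affine_flat j)) /=; last first.
  move=> J /andP[/eqP cJ /eqP rJ].
  by rewrite /affine_flat rkbar_closure closure_closed rk_closure // cJ rJ !eqxx.
rewrite mulr_sumr; apply: eq_bigr => X fX.
rewrite (eq_bigl _ _ (fun J => closure_eq J fX)).
by case/and3P: fX => _ /eqP rX _; rewrite /flat_sum rX.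
Qed.

Lemma torsion_sum_le j a b : (0 < b)%N -> (a %| b)%N ->
  torsion_sum j a <= torsion_sum j b.
Proof.
by move=> b_gt0 ab; rewrite !torsion_sumE ler_sum // => X _; exact: flat_sum_le.
Qed.

(** An independent set of [j] rows is consistent, its augmented rank being at most its size; its
    closure gives one positive term among nonnegative ones. *)
Lemma torsion_sum1_gt0 j : (forall i, row i A != 0) -> (j <= rankQ A)%N ->
  0 < torsion_sum j 1.
Proof.
move=> nzA le_j; rewrite -rk_setT in le_j.
have [J cardJ rJ] := ex_independent (rk_matroid A) le_j (rk_set0 A).
have cJ : rkbar A av J = rk A J.
  apply/eqP; rewrite eqn_leq rk_leq_rkbar andbT rJ -cardJ rkbarE.
  exact: rk_leq_card.
have fJ : affine_flat j (closure J).
  by rewrite /affine_flat rkbar_closure closure_closed rk_closure // cJ rJ !eqxx.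
rewrite torsion_sumE (bigD1 (closure J)) //= ltr_pwDl ?flat_sum1_gt0 //.
by rewrite sumr_ge0 // => X _; rewrite flat_sum_ge0.
Qed.

Lemma dinv_dvd_rhoC J k : rkbar A av J = rk A J -> (k < rk A J)%N ->
  (dinv A J k.+1 %| rhoC A av)%N.
Proof.
move=> cJ lt_k; apply: (@dvdn_trans (dinv A J (rk A J))).
  rewrite /dinv; case: (rk A J) lt_k => // r lt_k; exact: invariant_factor_dvd.
by apply: (biglcmn_sup J) => //; apply/eqP.
Qed.

(** The invariant factors that occur all divide [rhoC], so they see [c] only through its gcd with
    [rhoC]. *)
Lemma torsion_sum_gcdn j c :
  torsion_sum j c = torsion_sum j (gcdn c (rhoC A av)).
Proof.
congr (_ * _); apply: eq_bigr => J /andP[/eqP cJ _]; congr (_ * Posz _).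
apply: eq_bigr => k _; rewrite [gcdn c _]gcdnC gcdnA; congr gcdn.
by apply/esym/gcdn_idPl/dinv_dvd_rhoC.
Qed.

Definition flats_solvable c : Prop := forall J, rkbar A av J = rk A J ->
  solvable_mod c (rowsof A J) (rowsof av J).

Lemma beta_torsion_sum j c : (0 < c)%N -> flats_solvable c ->
  beta A av j c = torsion_sum j c.
Proof.
move=> c_gt0 sol; congr (_ * _); apply: eq_bigr => J /andP[/eqP cJ _].
congr (_ * Posz _); rewrite /dtilde ifT //; apply/forallP => k.
rewrite ![gcdn c _]gcdnC; apply/eqP.
apply: solvable_mod_gcdn (sol J cJ) => //.
exact: leq_trans (ltn_ord k) (rk_leq_card A J).
Qed.

Lemma flats_solvable_lift q c : (0 < c)%N -> (gcdn c (rhoC A av) %| q)%N ->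
  flats_solvable q -> flats_solvable c.
Proof.
move=> c_gt0 dvd_q sol J cJ; apply: (solvable_mod_lift cJ c_gt0 _ (sol J cJ)).
apply: dvdn_trans dvd_q; rewrite dvdn_gcd dvdn_gcdl /=.
apply: dvdn_trans (dvdn_gcdr _ _) _; rewrite -/(rk A J) -/(dinv A J _).
(* In rank 0 the convention [d_{J,0} = 1] applies. *)
case rJ: (rk A J) => [|r]; first exact: dvd1n.
by apply: dinv_dvd_rhoC; rewrite ?cJ ?rJ.
Qed.
End Affine.

(** * Dimensions of real flats and the Whitney numbers *)

Lemma kernel_vspace (K : fieldType) p n (M : 'M[K]_(p, n)) :
  exists2 U : {vspace 'cV[K]_n}, \dim U = (n - \rank M)%N &
    forall x, (x \in U) = (M *m x == 0).
Proof.
pose N := (row_base (kermx M^T))^T.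
pose f : 'Hom('cV[K]_(\rank (kermx M^T)), 'cV[K]_n) := linfun (mulmx N).
have injf : lker f == 0%VS.
  apply/lker0P => v w; rewrite !lfunE /= => /(congr1 trmx).
  rewrite !trmx_mul trmxK.
  by move/(row_free_inj (row_base_free _))/trmx_inj.
exists (limg f) => [|x].
  rewrite limg_dim_eq; last by apply/eqP; rewrite (eqP injf) capv0.
  by rewrite dimvf /dim /= muln1 mxrank_ker mxrank_tr.
apply/memv_imgP/eqP => [[v _ ->]|Mx].
  rewrite lfunE /= mulmxA; apply: trmx_inj.
  rewrite trmx_mul trmx0 trmx_mul trmxK.
  suff /eqP-> : row_base (kermx M^T) *m M^T == 0 by rewrite mulmx0.
  by rewrite -sub_kermx eq_row_base.
have : (x^T <= row_base (kermx M^T))%MS.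
  by rewrite eq_row_base sub_kermx -trmx_mul Mx trmx0.
case/submxP=> D xE; exists D^T; first exact: memvf.
by rewrite lfunE /= -trmx_mul -xE trmxK.
Qed.

Lemma affine_dim_solutions (K : fieldType) p n (M : 'M[K]_(p, n))
    (v : 'cV[K]_p) (x0 : 'cV[K]_n) :
  M *m x0 = v -> affine_dim [set x | M *m x = v]%classic = (n - \rank M)%N.
Proof.
move=> Mx0; have [U dimU UE] := kernel_vspace M.
apply: xget_unique.
  exists x0, U; split=> //; apply/seteqP.
  split=> x /=; rewrite UE mulmxBr Mx0 subr_eq0.
    by move=> ->.
  by move/eqP.
(* Any other presentation has the same direction: its base point [x1] is a solution, so [V] is again
   the kernel of [M]. *)
move=> k [x1 [V [/seteqP[sub1 sub2] <-]]]; rewrite -dimU; congr (\dim _).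
have Mx1 : M *m x1 = v by apply: sub2; rewrite /= subrr mem0v.
apply/vspaceP => x; rewrite UE; apply/idP/eqP => [Vx|Mx].
  have /= := sub2 (x + x1); rewrite addrK mulmxDr Mx1 => /(_ Vx) h.
  by apply: (addIr v); rewrite add0r.
by have /= := sub1 (x + x1); rewrite addrK mulmxDr Mx1 Mx add0r; apply.
Qed.

Section Whitney.
Variables (R : realType) (m n : nat) (A : 'M[int]_(m, n)) (av : 'cV[int]_m).
Implicit Types (J : {set 'I_m}) (j : nat).

Lemma rank_map_intr p k (M : 'M[int]_(p, k)) :
  \rank (map_mx intr M : 'M[R]_(p, k)) = rankQ M.
Proof.
rewrite /rankQ -(mxrank_map (@ratr R)) -map_mx_comp; congr (\rank _).
by apply/matrixP => i l; rewrite !mxE /= ratr_int.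
Qed.

Lemma flatE J : @flat m n A av R J =
  [set x | map_mx intr (rowsof A J) *m x = map_mx intr (rowsof av J)]%classic.
Proof.
have rowE (x : 'cV[R]_n) k : (map_mx intr (rowsof A J) *m x) k 0 =
    (row (enum_val k) (map_mx intr A) *m x) 0 0.
  by rewrite !mxE; apply: eq_bigr => l _; rewrite !mxE.
apply/seteqP; split=> x /= => [Jx|/matrixP Jx].
  apply/matrixP => k l; rewrite ord1 rowE.
  by have -> := Jx _ (enum_valP k); rewrite !mxE.
move=> i iJ; apply/matrixP => k l; rewrite !ord1.
by have := Jx (enum_rank_in iJ i) 0; rewrite rowE !mxE enum_rankK_in.
Qed.

Lemma flat_nonempty J :
  (@flat m n A av R J !=set0)%classic <-> rkbar A av J = rk A J.
Proof.
rewrite flatE /rkbar /rk -!rank_map_intr /augmented map_row_mx.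
exact: solvable_rank.
Qed.

Lemma whitney_torsion_sum j : (j <= rankQ A)%N ->
  whitney A av R j = torsion_sum A av j 1.
Proof.
move=> le_j; rewrite /whitney /torsion_sum; congr (_ * _).
have le_jn : (j <= n)%N by rewrite (leq_trans le_j) ?rank_leq_col.
rewrite /charpoly coef_sum.
rewrite (eq_bigl (fun J => rkbar A av J == rk A J)); last first.
  by move=> J; apply/asboolP/eqP; apply flat_nonempty.
rewrite big_mkcondr /=; apply: eq_bigr => J /eqP cJ.
have /flat_nonempty[x] := cJ; rewrite flatE => /= Jx.
rewrite (affine_dim_solutions Jx) rank_map_intr -/(rk A J) coefZ coefXn.
rewrite big1 => [|k _]; last by rewrite gcdn1.
(* Both [j] and the rank are at most [n], so the truncated subtraction loses nothing. *)
have -> : ((n - j)%N == (n - rk A J)%N) = (rk A J == j).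
  apply/eqP/eqP => [sub_eq|->//].
  by rewrite -(subKn (rk_leq_n A J)) -sub_eq subKn.
by case: eqP => _; rewrite ?mulr1 ?mulr0.
Qed.
End Whitney.

(** * The chain of inequalities *)

(** Common core of both claims, which differ in where solvability modulo [q] comes from. It passes
    to [b], [a] and 1, whose gcds with [rhoC] divide [q]; all coefficients become torsion sums, and
    monotonicity is applied to the gcds. *)
Lemma coefficient_inequalities (R : realType) (m n : nat)
    (A : 'M[int]_(m, n)) (av : 'cV[int]_m) (q a b j : nat) :
  (forall i, row i A != 0) -> (0 < a)%N -> (0 < b)%N -> (0 < q)%N ->
  (gcdn a (rhoC A av) %| gcdn b (rhoC A av))%N ->
  gcdn b (rhoC A av) = gcdn q (rhoC A av) ->
  flats_solvable A av q -> (j <= rankQ A)%N ->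
  [/\ 0 < whitney A av R j,
      whitney A av R j = gamma A av j 1,
      gamma A av j 1 <= gamma A av j a,
      gamma A av j a <= gamma A av j b &
      gamma A av j b = beta A av j q].
Proof.
move=> nzA a_gt0 b_gt0 q_gt0 dvd_ab bq sol le_j.
have solb : flats_solvable A av b.
  by apply: flats_solvable_lift sol => //; rewrite bq dvdn_gcdl.
have sola : flats_solvable A av a.
  apply: flats_solvable_lift sol => //.
  by rewrite (dvdn_trans dvd_ab) // bq dvdn_gcdl.
have sol1 : flats_solvable A av 1.
  by apply: flats_solvable_lift sol; rewrite ?gcd1n ?dvd1n.
rewrite /gamma !beta_torsion_sum // whitney_torsion_sum //.
split=> //; first exact: torsion_sum1_gt0.
- by apply: torsion_sum_le; rewrite ?dvd1n.
- rewrite torsion_sum_gcdn [leRHS]torsion_sum_gcdn.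
  by apply: torsion_sum_le; rewrite // gcdn_gt0 b_gt0.
- by rewrite torsion_sum_gcdn bq -torsion_sum_gcdn.
Qed.

Theorem corollary3p9 (R : realType) (m n : nat)
    (A : 'M[int]_(m, n)) (av : 'cV[int]_m)
    (nzA : forall i : 'I_m, row i A != 0) :
  (forall q a b : nat,
      (q0 A av < q)%N ->
      (1 <= a <= rhoC A av)%N ->
      (1 <= b <= rhoC A av)%N ->
      (gcdn a (rhoC A av) %| gcdn b (rhoC A av))%N ->
      gcdn b (rhoC A av) = gcdn q (rhoC A av) ->
      comb_equiv A av (gcdn a (rhoC A av)) (gcdn b (rhoC A av)) ->
      (forall J : {set 'I_m}, rkbar A av J = rk A J ->
         redmx q (rowsof av J) \in Colq q (rowsof A J)) ->
      forall j : nat, (j <= rankQ A)%N ->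
        [/\ 0 < whitney A av R j,
            whitney A av R j = gamma A av j 1,
            gamma A av j 1 <= gamma A av j a,
            gamma A av j a <= gamma A av j b &
            gamma A av j b = beta A av j q])
  /\
  (av = 0 ->
   forall q a b : nat,
      (1 <= q)%N ->
      (1 <= a <= rhoC A av)%N ->
      (1 <= b <= rhoC A av)%N ->
      (gcdn a (rhoC A av) %| gcdn b (rhoC A av))%N ->
      gcdn b (rhoC A av) = gcdn q (rhoC A av) ->
      forall j : nat, (j <= rankQ A)%N ->
        [/\ 0 < whitney A av R j,
            whitney A av R j = gamma A av j 1,
            gamma A av j 1 <= gamma A av j a,
            gamma A av j a <= gamma A av j b &
            gamma A av j b = beta A av j q]).
Proof.
split=> [q a b lt_q|av0 q a b q_gt0] /andP[a_gt0 _] /andP[b_gt0 _] dvd_ab bq.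
  move=> _ sol j; apply: coefficient_inequalities => // [|J cJ].
    exact: leq_ltn_trans lt_q.
  by apply: Colq_solvable_mod (sol J cJ); exact: leq_ltn_trans lt_q.
(* A homogeneous system has the zero solution modulo every [q]. *)
move=> j; apply: coefficient_inequalities => // J _; exists 0, 0.
by rewrite mulmx0 scaler0 addr0 av0; apply/matrixP => k l; rewrite !mxE.
Qed.
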